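(* Let $\zeta$ be a stationary particle process on $\mathbb{H}^d$ with intensity measure $\Lambda$, and let $\gamma\in(0,\infty]$ be its intensity (for a given center function $c_h$). Then the following conditions are equivalent. (a) $\Lambda([C])<\infty$ for all compact sets $C\subset\mathbb{H}^d$. (b) $\Lambda([\mathbb{B}_1])<\infty$ (instead of $\mathbb{B}_1$ any compact set with nonempty interior may be chosen). (c) $\gamma<\infty$ and $\mathbf{E}\,\overline{V}_d(\mathrm G)<\infty$, where $\mathrm G$ is the typical particle of $\zeta$.
   Context: $\mathbb{H}^d$ ($d\ge2$) is $d$-dimensional hyperbolic space of constant curvature $-1$ with metric $d_h$, $\mathsf p\in\mathbb{H}^d$ is a fixed point, $\mathbb{B}_r$ is the closed geodesic ball with center $\mathsf p$ and radius $r$, and $V_d=\mathcal{H}^d$ is the volume ($d$-dimensional Hausdorff measure). For nonempty $A\subseteq\mathbb{H}^d$, $\overline{V}_d(A)=V_d(\{x:d_h(A,x)\le1\})$ with $d_h(A,x)=\inf_{a\in A}d_h(a,x)$. $\mathcal{I}_d$ is the isometry group; $\lambda$ is its Haar measure (left, right and inversion invariant) normalized by $\mathcal{H}^d=\int_{\mathcal{I}_d}\mathbf{1}\{\varrho x\in\cdot\}\lambda(d\varrho)$ for all $x\in\mathbb{H}^d$. $\mathcal{C}^d$ is the space of nonempty compact subsets of $\mathbb{H}^d$ with the Hausdorff metric and its Borel $\sigma$-field; $[C]=\{K\in\mathcal{C}^d:K\cap C\ne\varnothing\}$. A particle process is a point process $\zeta$ on $\mathcal{C}^d$ with $\zeta([C])<\infty$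 almost surely for all compact $C$; it is stationary if $\varrho\zeta\overset{d}{=}\zeta$ for all $\varrho\in\mathcal{I}_d$ (image under $K\mapsto\varrho K$). $\Lambda=\mathbf{E}\zeta$ is its intensity measure. A center function is a measurable map $c_h\colon\mathcal{C}^d\to\mathbb{H}^d$ with $c_h(\varrho K)=\varrho c_h(K)$ for all $K,\varrho$. The intensity is $\gamma=\int_{\mathcal{C}^d}\mathbf{1}\{c_h(K)\in\mathbb{B}\}\Lambda(dK)$ with $\mathbb{B}$ a ball of volume $1$. Typical particle: if $\gamma\in(0,\infty)$, there is a unique probability measure $\mathbf{Q}$ on $\mathcal{C}^d$ concentrated on $\{K\in\mathcal C^d:c_h(K)=\mathsf p\}$, invariant under isometries fixing $\mathsf p$, with $\Lambda=\gamma\int_{\mathcal{C}^d}\int_{\mathcal{I}_d}\mathbf{1}\{\varrho K\in\cdot\}\lambda(d\varrho)\mathbf{Q}(dK)$; the typical particle $\mathrm G$ is a random element of $\mathcal{C}^d$ with distribution $\mathbf{Q}$. *)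

(* Defs.v *)
From HB Require Import structures.
From mathcomp Require Import all_boot all_order all_algebra.
From mathcomp Require Import all_classical all_reals all_analysis measurable_realfun.
From mathcomp Require Import ring lra.

Set Implicit Arguments.
Unset Strict Implicit.
Unset Printing Implicit Defensive.

Import Order.TTheory GRing.Theory Num.Theory.
Import numFieldNormedType.Exports.

Local Open Scope classical_set_scope.
Local Open Scope ring_scope.

Definition borel (T : ptopologicalType) := g_sigma_algebraType (@open T).
HB.instance Definition _ (T : ptopologicalType) := Measurable.on (borel T).

#[short(type="pmetricType")]
HB.structure Definition PointedMetric (R : numDomainType) :=
  { M of Pointed M & Metric R M }.

Section metric_notions.
Context {R : realType} {M : metricType R}.
Implicit Types (A B : set M) (x y : M).

Definition cball x (r : R) : set M := [set y | mdist x y <= r].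

(* The infimum is only meaningful for nonempty [A]: [inf set0 = 0]. *)
Definition dist_set A x : R := inf [set mdist a x | a in A].

Definition parallel_set A (r : R) : set M := [set x | dist_set A x <= r].

Local Open Scope ereal_scope.

Definition diam A : \bar R :=
  maxe 0 (ereal_sup [set (mdist x y)%:E | x in A & y in A]).

End metric_notions.

(* [pi^(n/2) / Gamma(n/2 + 1)], the volume of the Euclidean unit ball, by its
   two-step recurrence. *)
Fixpoint unit_ball_volume (R : realType) (n : nat) : R :=
  match n with
  | 0 => 1
  | 1 => 2
  | (m.+1 as k).+1 => 2 * pi / k.+1%:R * unit_ball_volume R m
  end.

Section hausdorff_measure.
Context {R : realType} {M : metricType R}.
Local Open Scope ereal_scope.

Definition hausdorff_content (n : nat) (delta : R) (A : set M) : \bar R :=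
  ereal_inf [set \sum_(i <oo) ((unit_ball_volume R n / 2 ^+ n)%:E * diam (U i) ^+ n)
            | U in [set U : (set M)^nat |
                A `<=` \bigcup_i U i /\ forall i, diam (U i) <= delta%:E]].

(* Defined on all subsets; its restriction to Borel sets is a measure. The
   normalization makes it agree with Lebesgue measure on Euclidean space and
   with the Riemannian volume on hyperbolic space. *)
Definition hausdorff_measure (n : nat) (A : set M) : \bar R :=
  ereal_sup [set hausdorff_content n delta A | delta in [set e : R | (0 < e)%R]].

End hausdorff_measure.

Lemma isometric_continuous {R : realType} {M N : metricType R} (f : M -> N) :
  (forall x y, mdist (f x) (f y) = mdist x y) -> continuous f.
Proof.
move=> fd x; apply/metricType_numDomainType.cvgrPdist_lt => e e0.
apply/metricType_numDomainType.nbhs_mdistP; exists e => //= y.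
by rewrite fd.
Qed.

Record isometry_group (R : realType) (M : metricType R) := Isometry {
  isom_fun :> M -> M ;
  isom_inv : M -> M ;
  isom_funK : cancel isom_fun isom_inv ;
  isom_invK : cancel isom_inv isom_fun ;
  isom_dist : forall x y, mdist (isom_fun x) (isom_fun y) = mdist x y
}.

Section isometries.
Context {R : realType} {M : metricType R}.
Implicit Types f g : isometry_group M.

Lemma isom_ext f g : isom_fun f = isom_fun g -> f = g.
Proof.
case: f g => [f f' fK f'K df] [g g' gK g'K dg] /= fg.
rewrite -{g}fg in gK g'K dg *.
have E : f' = g' by apply/funext => x; rewrite -[in RHS](f'K x) gK.
rewrite -{g'}E in gK g'K *.
by congr Isometry; exact: Prop_irrelevance.
Qed.

Definition isom_oneg : isometry_group M :=
  Isometry (fun=> erefl) (fun=> erefl) (fun _ _ => erefl).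

Program Definition isom_mulg f g : isometry_group M :=
  @Isometry R M (f \o g) (isom_inv g \o isom_inv f) _ _ _.
Next Obligation. by move=> f g x /=; rewrite !isom_funK. Qed.
Next Obligation. by move=> f g x /=; rewrite !isom_invK. Qed.
Next Obligation. by move=> f g x y /=; rewrite !isom_dist. Qed.

Program Definition isom_invg f : isometry_group M :=
  @Isometry R M (isom_inv f) f (isom_invK f) (isom_funK f) _.
Next Obligation. by move=> f x y; rewrite -(isom_dist f) !isom_invK. Qed.

Lemma isom_continuous f : continuous f.
Proof. exact: isometric_continuous (isom_dist f). Qed.

HB.instance Definition _ := gen_eqMixin (isometry_group M).
HB.instance Definition _ := gen_choiceMixin (isometry_group M).
HB.instance Definition _ := isPointed.Build (isometry_group M) isom_oneg.
HB.instance Definition _ := Topological.copy (isometry_group M)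
  (initial_topology (@isom_fun R M : isometry_group M -> {compact-open, M -> M})).

End isometries.

Record particle (R : realType) (M : metricType R) := Particle {
  pset_of :> set M ;
  particle_compact : compact pset_of ;
  particle_neq0 : pset_of !=set0
}.

Section dist_set_theory.
Context {R : realType} {M : metricType R}.
Implicit Types (A : set M) (x y : M).

Lemma dist_set_has_inf A x : A !=set0 -> has_inf [set mdist a x | a in A].
Proof.
move=> [a Aa]; split; first by exists (mdist a x), a.
by exists 0 => _ [b _ <-]; exact: mdist_ge0.
Qed.

Lemma dist_set_ge0 A x : 0 <= dist_set A x.
Proof.
have [[a Aa]|/set0P/negP/negPn/eqP ->] := pselect (A !=set0).
  apply: lb_le_inf; first by exists (mdist a x), a.
  by move=> _ [b _ <-]; exact: mdist_ge0.
by rewrite /dist_set image_set0 inf0.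
Qed.

Lemma dist_set_le A a x : A a -> dist_set A x <= mdist a x.
Proof.
move=> Aa; apply: ge_inf; last by exists a.
by exists 0 => _ [b _ <-]; exact: mdist_ge0.
Qed.

Lemma dist_set_approx A x (e : R) : A !=set0 -> 0 < e ->
  exists2 a, A a & mdist a x < dist_set A x + e.
Proof.
move=> A0 e0; have [_ [a Aa <-] ?] := inf_adherent e0 (dist_set_has_inf x A0).
by exists a.
Qed.

Lemma dist_set_lip A x y : A !=set0 -> dist_set A x <= dist_set A y + mdist y x.
Proof.
move=> A0; apply/ler_addgt0Pr => e e0.
have [a Aa ay] := dist_set_approx y A0 e0.
apply: (le_trans (dist_set_le x Aa)).
apply: (le_trans (metric_triangle a y x)); rewrite addrAC lerD2r; exact: ltW.
Qed.

Lemma dist_set_continuous A : A !=set0 -> continuous (dist_set A : M -> R).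
Proof.
move=> A0 x; apply/cvgrPdist_lt => e e0.
apply/metricType_numDomainType.nbhs_mdistP; exists e => //= y /=.
have := dist_set_lip x y A0; have := dist_set_lip y x A0.
rewrite (metric_sym (y : M) x).
move: (mdist x y) (dist_set A x) (dist_set A y) => u v w h1 h2 /= h3.
by rewrite ltr_norml; apply/andP; split; lra.
Qed.

End dist_set_theory.

Section hausdorff_metric.
Context {R : realType} {M : metricType R}.
Implicit Types (K L N : particle M).

Definition excess K L : R := sup [set dist_set L x | x in K].

Definition hausdorff_dist K L : R := Num.max (excess K L) (excess L K).

Lemma excess_has_sup K L : has_sup [set dist_set L x | x in K].
Proof.
apply: compact_has_sup.
  by have [x Kx] := particle_neq0 K; exists (dist_set L x), x.
apply: continuous_compact; last exact: particle_compact.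
apply: continuous_subspaceT; apply: dist_set_continuous.
exact: particle_neq0.
Qed.

Lemma excess_ub K L x : pset_of K x -> dist_set L x <= excess K L.
Proof.
move=> Kx; apply: ub_le_sup; last by exists x.
by have [] := excess_has_sup K L.
Qed.

Lemma excess_le K L (r : R) :
  (forall x, pset_of K x -> dist_set L x <= r) -> excess K L <= r.
Proof.
move=> h; apply: ge_sup; first by have [] := excess_has_sup K L.
by move=> _ [x Kx <-]; exact: h.
Qed.

Lemma excess_ge0 K L : 0 <= excess K L.
Proof.
have [x Kx] := particle_neq0 K.
exact: le_trans (dist_set_ge0 L x) (excess_ub L Kx).
Qed.

Lemma excess_triangle K L N : excess K N <= excess K L + excess L N.
Proof.
apply: excess_le => x Kx; apply/ler_addgt0Pr => e e0.
have [a La ax] := dist_set_approx x (particle_neq0 L) e0.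
have := dist_set_lip x a (particle_neq0 N).
have := excess_ub N La; have := excess_ub L Kx; lra.
Qed.

Lemma excess_eq0 K L : excess K L = 0 -> pset_of K `<=` pset_of L.
Proof.
move=> KL x Kx.
have cL : closed (pset_of L).
  by apply: compact_closed; [exact: metric_hausdorff|exact: particle_compact].
have -> : pset_of L x = closure (pset_of L) x by rewrite -(closure_id _).1.
move=> B /metricType_numDomainType.nbhs_mdistP.
move=> [e /= e0 eB].
have [a La ax] := dist_set_approx x (particle_neq0 L) e0.
exists a; split => //; apply: eB; rewrite /= metric_sym (lt_le_trans ax)//.
by have := excess_ub L Kx; rewrite KL; lra.
Qed.

Lemma excessxx K : excess K K = 0.
Proof.
apply/eqP; rewrite eq_le excess_ge0 andbT; apply: excess_le => x Kx.
by rewrite -(mdistxx x); exact: dist_set_le.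
Qed.

Lemma particle_ext K L : pset_of K = pset_of L -> K = L.
Proof.
case: K L => [K cK K0] [L cL L0] /= KL.
by rewrite -{L}KL in cL L0 *; congr Particle; exact: Prop_irrelevance.
Qed.

Let hausdorff_distxx K : hausdorff_dist K K = 0.
Proof. by rewrite /hausdorff_dist maxxx excessxx. Qed.

Let hausdorff_dist_positivity K L : hausdorff_dist K L = 0 -> K = L.
Proof.
move=> KL; apply: particle_ext.
have h : excess K L <= 0 /\ excess L K <= 0.
  by rewrite -KL /hausdorff_dist !le_max !lexx orbT.
apply/seteqP; split; apply: excess_eq0; apply/eqP; rewrite eq_le excess_ge0;
  by rewrite andbT; case: h.
Qed.

Let hausdorff_dist_sym K L : hausdorff_dist K L = hausdorff_dist L K.
Proof. by rewrite /hausdorff_dist maxC. Qed.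

Let hausdorff_dist_triangle L K N :
  hausdorff_dist K N <= hausdorff_dist K L + hausdorff_dist L N.
Proof.
rewrite {1}/hausdorff_dist ge_max; apply/andP; split.
  apply: (le_trans (excess_triangle K L N)).
  by apply: lerD; rewrite /hausdorff_dist le_max lexx.
apply: (le_trans (excess_triangle N L K)); rewrite addrC.
by apply: lerD; rewrite /hausdorff_dist le_max lexx orbT.
Qed.

HB.instance Definition _ := gen_eqMixin (particle M).
HB.instance Definition _ := gen_choiceMixin (particle M).
HB.instance Definition _ := @isMetric.Build R (particle M) hausdorff_dist
  hausdorff_distxx hausdorff_dist_positivity hausdorff_dist_sym
  hausdorff_dist_triangle.

End hausdorff_metric.

HB.instance Definition _ (R : realType) (M : pmetricType R) :=
  isPointed.Build (particle M)
    (Particle (@compact_set1 M point) (ex_intro _ point erefl)).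

Definition hitting (R : realType) (M : metricType R) (C : set M)
  : set (particle M) := [set K | pset_of K `&` C !=set0].

Section isometry_action.
Context {R : realType} {M : pmetricType R}.
Implicit Types (f : isometry_group M) (K L : particle M).

Program Definition isom_act f K : particle M := @Particle R M (f @` K) _ _.
Next Obligation.
move=> f K; apply: continuous_compact; last exact: particle_compact.
by apply: continuous_subspaceT; exact: isom_continuous.
Qed.
Next Obligation.
by move=> f K; have [x Kx] := particle_neq0 K; exists (f x), x.
Qed.

Lemma dist_set_isom f (A : set M) x : dist_set (f @` A) (f x) = dist_set A x.
Proof.
rewrite /dist_set image_comp; congr inf; apply: eq_imagel => a _ /=.
by rewrite isom_dist.
Qed.

Lemma excess_isom f K L : excess (isom_act f K) (isom_act f L) = excess K L.
Proof.
rewrite /excess /= image_comp; congr sup; apply: eq_imagel => a _ /=.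
by rewrite dist_set_isom.
Qed.

Lemma isom_act_dist f K L : mdist (isom_act f K) (isom_act f L) = mdist K L.
Proof. by rewrite /mdist/= /hausdorff_dist !excess_isom. Qed.

Lemma isom_act_continuous f : continuous (isom_act f).
Proof. exact: isometric_continuous (isom_act_dist f). Qed.

Definition particle_act f : borel (particle M) -> borel (particle M) :=
  isom_act f.

Let measurable_particle_act f : measurable_fun setT (particle_act f).
Proof.
apply: (@measurability _ _ _ _ setT (particle_act f) open) => //.
move=> _ [B oB <-]; rewrite setTI; apply: sub_sigma_algebra.
by apply: open_comp => // x _; exact: isom_act_continuous.
Qed.

HB.instance Definition _ f :=
  isMeasurableFun.Build _ _ _ _ (particle_act f) (measurable_particle_act f).

Section image_measure.
Variables (f : isometry_group M) (mu : {measure set (borel (particle M)) -> \bar R}).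

Definition particle_image : set (borel (particle M)) -> \bar R :=
  pushforward mu (particle_act f).

Let particle_image0 : particle_image set0 = 0%E.
Proof. exact: measure0. Qed.

Let particle_image_ge0 A : (0 <= particle_image A)%E.
Proof. exact: measure_ge0. Qed.

Let particle_image_sigma_additive : semi_sigma_additive particle_image.
Proof. exact: measure_semi_sigma_additive. Qed.

HB.instance Definition _ := isMeasure.Build _ _ _ particle_image
  particle_image0 particle_image_ge0 particle_image_sigma_additive.

End image_measure.

End isometry_action.

Section hyperbolic.
Context {R : realType} {d : nat}.
Implicit Types x y z : 'rV[R]_d.+1.

(* The opposite of the Minkowski form: [cosh] of the distance. *)
Definition lorentz x y : R :=
  x 0 0 * y 0 0 - \sum_(i < d) x 0 (lift ord0 i) * y 0 (lift ord0 i).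

Definition on_hyperboloid x := (lorentz x x == 1) && (0 < x 0 0).

End hyperbolic.

(* Hyperboloid model; [hyp_dist] below is its distance of curvature [-1]. *)
Record hyperbolic_space (R : realType) (d : nat) := Hyperbolic {
  hyp_val :> 'rV[R]_d.+1 ;
  hyp_valP : on_hyperboloid hyp_val
}.

HB.instance Definition _ (R : realType) (d : nat) :=
  [isSub for @hyp_val R d].
HB.instance Definition _ (R : realType) (d : nat) :=
  [Choice of hyperbolic_space R d by <:].

Definition arcosh {R : realType} (t : R) : R := ln (t + Num.sqrt (t ^+ 2 - 1)).

Section hyperbolic_metric.
Context {R : realType} {d : nat}.
Implicit Types x y z : 'rV[R]_d.+1.
Implicit Types p q r : hyperbolic_space R d.

Let euc x y : R := \sum_(i < d) x 0 (lift ord0 i) * y 0 (lift ord0 i).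

Let lorentzE x y : lorentz x y = x 0 0 * y 0 0 - euc x y.
Proof. by []. Qed.

Let eucC x y : euc x y = euc y x.
Proof. by apply: eq_bigr => i _; rewrite mulrC. Qed.

Let eucD x y z (k : R) : euc (x + k *: y) z = euc x z + k * euc y z.
Proof.
rewrite /euc mulr_sumr -big_split/=; apply: eq_bigr => i _.
by rewrite !mxE; ring.
Qed.

Let euc_ge0 x : 0 <= euc x x.
Proof. by apply: sumr_ge0 => i _; rewrite -expr2 sqr_ge0. Qed.

Lemma lorentzC x y : lorentz x y = lorentz y x.
Proof. by rewrite !lorentzE eucC mulrC. Qed.

Let lorentzD x y z (k : R) :
  lorentz (x + k *: y) z = lorentz x z + k * lorentz y z.
Proof. by rewrite !lorentzE eucD !mxE; ring. Qed.

(* Cauchy-Schwarz from a semidefinite binary quadratic form *)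
Let quad_cs (a b c : R) :
  0 <= c -> (forall k, 0 <= a + 2 * k * b + k ^+ 2 * c) -> b ^+ 2 <= a * c.
Proof.
move=> c0 h.
have [cE|cN0] := eqVneq c 0.
  rewrite {}cE in h *.
  rewrite mulr0; have [->|bN0] := eqVneq b 0; first by rewrite expr0n.
  have := h (- (a + 1) / (2 * b)).
  have -> : a + 2 * (- (a + 1) / (2 * b)) * b + (- (a + 1) / (2 * b)) ^+ 2 * 0
    = -1 by field.
  by rewrite lerNr oppr0 ler10.
have cp : 0 < c by rewrite lt_neqAle eq_sym cN0.
have := h (- b / c).
have -> : a + 2 * (- b / c) * b + (- b / c) ^+ 2 * c = (a * c - b ^+ 2) / c.
  by field.
by rewrite pmulr_lge0 ?invr_gt0// subr_ge0.
Qed.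

Let euc_cs x y : euc x y ^+ 2 <= euc x x * euc y y.
Proof.
apply: quad_cs => [|k]; first exact: euc_ge0.
have := euc_ge0 (x + k *: y).
by rewrite eucD ![euc _ (x + _)]eucC !eucD (eucC y x); lra.
Qed.

Let hypE p : p 0%R 0%R ^+ 2 = 1 + euc p p /\ 0 < (p : 'rV[R]_d.+1) 0 0.
Proof.
by case/andP: (hyp_valP p) => /eqP; rewrite lorentzE => h ->; split; lra.
Qed.

Lemma lorentz_ge1 p q : 1 <= lorentz p q.
Proof.
have [p2 p0] := hypE p; have [q2 q0] := hypE q; have := euc_cs p q.
rewrite lorentzE; set a := _ 0 0 in p2 p0 *; set b := _ 0 0 in q2 q0 *.
move: (euc p p) (euc q q) (euc p q) p2 q2 (euc_ge0 p) (euc_ge0 q).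
move=> u v w p2 q2 u0 v0 h; rewrite leNgt; apply/negP => lt1.
have a1 : 1 <= a by nra.
have b1 : 1 <= b by nra.
have : (a * b - 1) ^+ 2 < w ^+ 2.
  have : 0 <= a * b - 1 by nra.
  have : a * b - 1 < w by lra.
  by move: (a * b - 1) => t ? ?; nra.
have : w ^+ 2 <= (a ^+ 2 - 1) * (b ^+ 2 - 1).
  by rewrite p2 q2; move: h; rewrite -subr_ge0 => ?; lra.
have := sqr_ge0 (a - b); rewrite !expr2; lra.
Qed.

Lemma lorentz_eq1 p q : lorentz p q = 1 -> p = q.
Proof.
have [p2 p0] := hypE p; have [q2 q0] := hypE q; have := euc_cs p q.
rewrite lorentzE => cs e.
have pq0 : (p : 'rV[R]_d.+1) 0 0 = (q : 'rV[R]_d.+1) 0 0.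
  move: cs e p2 q2 p0 q0; set a := hyp_val p 0 0; set b := hyp_val q 0 0.
  move: (euc p p) (euc q q) (euc p q) => u v w h e p2 q2 p0 q0.
  have : (a - b) ^+ 2 <= 0.
    have : w = a * b - 1 by lra.
    move=> W; move: h; rewrite W.
    have -> : u = a ^+ 2 - 1 by lra.
    have -> : v = b ^+ 2 - 1 by lra.
    rewrite !expr2; lra.
  by rewrite real_exprn_even_le0// ?num_real// subr_eq0 => /eqP.
have E : euc ((p : 'rV[R]_d.+1) + (-1) *: (q : 'rV[R]_d.+1))
             ((p : 'rV[R]_d.+1) + (-1) *: (q : 'rV[R]_d.+1)) = 0.
  rewrite eucD ![euc _ (_ + _)]eucC !eucD (eucC (q : 'rV[R]_d.+1) p).
  move: e p2 q2; rewrite pq0 expr2 => e p2 q2; lra.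
apply/val_inj/rowP => i /=; case: (unliftP ord0 i) => [j ->|->//].
have /eqP := E; rewrite psumr_eq0; last first.
  by move=> k _; rewrite -expr2 sqr_ge0.
move=> /allP/(_ j (mem_index_enum _)); rewrite !mxE -expr2 sqrf_eq0.
by rewrite mulN1r subr_eq0 => /eqP.
Qed.

Let spacelike x (p : hyperbolic_space R d) : lorentz x p = 0 -> lorentz x x <= 0.
Proof.
have [p2 p0] := hypE p; have := euc_cs x p; rewrite !lorentzE.
set a := x 0 0; set b := hyp_val p 0 0 in p2 p0 *.
move: (euc x x) (euc p p) (euc x p) (euc_ge0 x) (euc_ge0 p) p2.
move=> u v w u0 v0 p2 h e.
have {e}we : w = a * b by lra.
move: h; rewrite we => h.
have vE : v = b ^+ 2 - 1 by lra.
have : a ^+ 2 * b ^+ 2 <= u * b ^+ 2.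
  by rewrite -exprMn (le_trans h)// vE; nra.
by rewrite ler_pM2r ?exprn_gt0// => ?; lra.
Qed.

Let gram p q r (s := lorentz p q) (u := lorentz q r) :
  (lorentz p r - s * u) ^+ 2 <= (s ^+ 2 - 1) * (u ^+ 2 - 1).
Proof.
have /andP[/eqP pp _] := hyp_valP p; have /andP[/eqP qq _] := hyp_valP q.
have /andP[/eqP rr _] := hyp_valP r.
pose a : 'rV[R]_d.+1 := (p : 'rV[R]_d.+1) + (- s) *: (q : 'rV[R]_d.+1).
pose b : 'rV[R]_d.+1 := (r : 'rV[R]_d.+1) + (- u) *: (q : 'rV[R]_d.+1).
have aq : lorentz a q = 0 by rewrite lorentzD qq; rewrite -/s; lra.
have bq : lorentz b q = 0 by rewrite lorentzD qq (lorentzC r) -/u; lra.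
have aa : lorentz a a = 1 - s ^+ 2.
  rewrite {1}/a lorentzD ![lorentz _ a]lorentzC aq lorentzD pp (lorentzC q).
  by rewrite -/s; lra.
have bb : lorentz b b = 1 - u ^+ 2.
  rewrite {1}/b lorentzD ![lorentz _ b]lorentzC bq lorentzD rr.
  by rewrite -/u; lra.
have ab : lorentz a b = lorentz p r - s * u.
  rewrite {1}/a lorentzD ![lorentz _ b]lorentzC bq lorentzD.
  by rewrite (lorentzC r) (lorentzC q) -/s; lra.
clearbody a b; have := @quad_cs (s ^+ 2 - 1) (- (lorentz p r - s * u)) (u ^+ 2 - 1).
rewrite sqrrN; apply=> [|k].
  by have := lorentz_ge1 q r; rewrite -/u expr2; nra.
rewrite -ab -oppr_le0.
have kq : lorentz (a + k *: b) q = 0 by rewrite lorentzD aq bq; lra.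
apply: le_trans (spacelike kq); rewrite lorentzD ![lorentz _ (a + _)]lorentzC.
by rewrite !lorentzD (lorentzC b a) aa bb; lra.
Qed.

Definition hyp_dist p q : R := arcosh (lorentz p q).

Let hyp_distxx p : hyp_dist p p = 0.
Proof.
have /andP[/eqP pp _] := hyp_valP p.
by rewrite /hyp_dist /arcosh pp expr1n subrr sqrtr0 addr0 ln1.
Qed.

Let hyp_dist_sym p q : hyp_dist p q = hyp_dist q p.
Proof. by rewrite /hyp_dist lorentzC. Qed.

Let hyp_dist_positivity p q : hyp_dist p q = 0 -> p = q.
Proof.
move=> e; apply: lorentz_eq1; have h := lorentz_ge1 p q.
have s0 := sqrtr_ge0 (lorentz p q ^+ 2 - 1).
by move: e => /eqP; rewrite /hyp_dist /arcosh ln_eq0; [move/eqP; lra|lra].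
Qed.

Let hyp_dist_triangle q p r : hyp_dist p r <= hyp_dist p q + hyp_dist q r.
Proof.
rewrite /hyp_dist /arcosh.
have := gram p q r; have := lorentz_ge1 p r.
have := lorentz_ge1 p q; have := lorentz_ge1 q r.
move: (lorentz p q) (lorentz q r) (lorentz p r) => s u t u1 s1 t1 g.
have s20 : 0 <= s ^+ 2 - 1 by rewrite expr2; nra.
have u20 : 0 <= u ^+ 2 - 1 by rewrite expr2; nra.
have t20 : 0 <= t ^+ 2 - 1 by rewrite expr2; nra.
have hs := sqr_sqrtr s20; have hu := sqr_sqrtr u20; have ht := sqr_sqrtr t20.
move: (sqrtr_ge0 (s ^+ 2 - 1)) (sqrtr_ge0 (u ^+ 2 - 1)) (sqrtr_ge0 (t ^+ 2 - 1)).
move: hs hu ht; set S := Num.sqrt (s ^+ 2 - 1); set U := Num.sqrt (u ^+ 2 - 1).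
set T := Num.sqrt (t ^+ 2 - 1) => hs hu ht S0 U0 T0.
rewrite -lnM ?posrE; [|lra|lra].
rewrite ler_ln ?posrE; [|lra|by rewrite mulr_gt0//; lra].
have h1 : t - s * u <= S * U.
  have SU : 0 <= S * U by rewrite mulr_ge0.
  have : (t - s * u) ^+ 2 <= (S * U) ^+ 2 by rewrite exprMn hs hu.
  rewrite leNgt => h; rewrite leNgt; apply/negP => lt; move/negP: h; apply.
  by rewrite ltr_pXn2r// ?nnegrE//; lra.
have W0 : 0 <= s * U + u * S by rewrite addr_ge0// mulr_ge0//; lra.
have h2 : T <= s * U + u * S.
  have le2 : t ^+ 2 <= (s * u + S * U) ^+ 2.
    have h0 : 0 <= s * u + S * U by rewrite addr_ge0// mulr_ge0//; lra.
    by rewrite ler_pXn2r ?nnegrE//; lra.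
  have e2 : (s * U + u * S) ^+ 2 = (s * u + S * U) ^+ 2 - 1.
    transitivity (s ^+ 2 * U ^+ 2 + u ^+ 2 * S ^+ 2 + 2 * s * u * S * U).
      by ring.
    transitivity (s ^+ 2 * u ^+ 2 + S ^+ 2 * U ^+ 2 + 2 * s * u * S * U - 1).
      by rewrite hs hu; ring.
    by ring.
  have : T ^+ 2 <= (s * U + u * S) ^+ 2 by rewrite e2 ht; lra.
  by rewrite ler_pXn2r ?nnegrE.
by rewrite mulrDl !mulrDr; lra.
Qed.

HB.instance Definition _ := @isMetric.Build R (hyperbolic_space R d) hyp_dist
  hyp_distxx hyp_dist_positivity hyp_dist_sym hyp_dist_triangle.

Lemma hyp_origin_subproof :
  on_hyperboloid (delta_mx 0 0 : 'rV[R]_d.+1).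
Proof.
rewrite /on_hyperboloid /lorentz big1.
  by rewrite !mxE !eqxx/= mulr1 subr0 eqxx ltr01.
by move=> i _; rewrite !mxE/= mul0r.
Qed.

HB.instance Definition _ :=
  isPointed.Build (hyperbolic_space R d) (Hyperbolic hyp_origin_subproof).

End hyperbolic_metric.

Section haar.
Context {R : realType} {d : nat}.
Local Notation H := (hyperbolic_space R d).
Local Open Scope ereal_scope.

Definition volume (A : set H) : \bar R := hausdorff_measure d A.

Definition parallel_volume (K : particle H) : \bar R :=
  volume (parallel_set K 1).

(* Regularity is not required: the isometry group is locally compact and second
   countable, where finiteness on compact sets implies it. *)
Definition haar_measure
    (lambda : {measure set (borel (isometry_group H)) -> \bar R}) : Prop :=
  [/\ forall (f : isometry_group H) (A : set (borel (isometry_group H))), measurable A ->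
        lambda (isom_mulg f @^-1` A) = lambda A,
      forall (f : isometry_group H) (A : set (borel (isometry_group H))), measurable A ->
        lambda (isom_mulg^~ f @^-1` A) = lambda A,
      forall A : set (borel (isometry_group H)), measurable A ->
        lambda (isom_invg @^-1` A) = lambda A &
      forall A : set (isometry_group H), compact A -> lambda A < +oo ].

Definition haar_normalized
    (lambda : {measure set (borel (isometry_group H)) -> \bar R}) : Prop :=
  forall (x : H) (A : set (borel H)), measurable A ->
    volume A = \int[lambda]_f (\1_A ((f : isometry_group H) x))%:E.

End haar.

Section point_process.
Context {R : realType} {dT : measure_display} {T : measurableType dT}.
Local Open Scope ereal_scope.

(* Point processes are taken to have values in the countable sums of finite
   integer-valued measures, so that no topology on [T] is involved. *)
Definition counting_measure (mu : {measure set T -> \bar R}) : Prop :=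
  exists nu : nat -> {measure set T -> \bar R},
    (forall i A, measurable A -> exists k : nat, nu i A = k%:R%:E) /\
    (forall A, measurable A -> mu A = \sum_(i <oo) nu i A).

Definition measure_sigma_algebra : set (set {measure set T -> \bar R}) :=
  <<s \bigcup_(A in measurable)
      preimage_set_system setT (fun mu : {measure set T -> \bar R} => mu A)
        measurable >>.

Context {dO : measure_display} {Omega : measurableType dO}.
Variables (P : probability Omega R) (zeta : R.-ker Omega ~> T).

Definition point_process : Prop := forall w, counting_measure (zeta w).

Definition intensity_measure (A : set T) : \bar R := \int[P]_w zeta w A.

Let intensity_measure0 : intensity_measure set0 = 0.
Proof.
by rewrite /intensity_measure; under eq_integral do rewrite measure0;
  rewrite integral0.
Qed.

Let intensity_measure_ge0 A : 0 <= intensity_measure A.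
Proof. by apply: integral_ge0 => w _; exact: measure_ge0. Qed.

Let intensity_measure_sigma_additive : semi_sigma_additive intensity_measure.
Proof.
move=> F mF tF mUF; rewrite [X in _ --> X](_ : _ =
    \sum_(n <oo) intensity_measure (F n)).
  by apply: is_cvg_ereal_nneg_natsum => n _; exact: intensity_measure_ge0.
rewrite /intensity_measure -integral_nneseries//; last first.
  by move=> n; exact: measurable_kernel.
by apply: eq_integral => w _; rewrite measure_semi_bigcup.
Qed.

HB.instance Definition _ := isMeasure.Build _ _ _ intensity_measure
  intensity_measure0 intensity_measure_ge0 intensity_measure_sigma_additive.

End point_process.

Section particle_process.
Context {R : realType} {d : nat}.
Local Notation H := (hyperbolic_space R d).
Local Notation Cd := (borel (particle H)).
Local Open Scope ereal_scope.

Context {dO : measure_display} {Omega : measurableType dO}.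
Variables (P : probability Omega R) (zeta : R.-ker Omega ~> Cd).

Definition particle_process : Prop :=
  point_process zeta /\
  forall C : set H, compact C -> {ae P, forall w, zeta w (hitting C) < +oo}.

Definition stationary : Prop :=
  forall (f : isometry_group H) (E : set {measure set Cd -> \bar R}),
    measure_sigma_algebra E ->
    P [set w | E (particle_image f (zeta w))] = P [set w | E (zeta w)].

Definition center_function (c : Cd -> borel H) : Prop :=
  measurable_fun setT c /\
  forall (f : isometry_group H) (K : particle H), c (particle_act f K) = f (c K).

(* [B] stands for a ball of volume 1. *)
Definition intensity (c : Cd -> borel H) (B : set H) : \bar R :=
  \int[intensity_measure P zeta]_K (\1_B (c K))%:E.

Definition typical_distribution (p : H)
    (lambda : {measure set (borel (isometry_group H)) -> \bar R})
    (c : Cd -> borel H) (gamma : \bar R) (Q : probability Cd R) : Prop :=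
  [/\ Q (~` [set K | c K = p]) = 0,
      forall f : isometry_group H, f p = p ->
        forall A : set Cd, measurable A -> Q (particle_act f @^-1` A) = Q A &
      forall A : set Cd, measurable A ->
        intensity_measure P zeta A =
        gamma * \int[Q]_K \int[lambda]_f (\1_A (particle_act f K))%:E ].

End particle_process.

(* Main.v *)
(* Write L for the intensity measure and v(K) for the volume of the parallel set of
   K at distance 1.  Isometries act transitively (reflections of the hyperboloid)
   and closed balls are compact, so stationarity makes L([C]) finite for all compact
   C as soon as it is finite for one C with nonempty interior.  When L([B_1]) is
   finite, L is sigma-finite, and integrating 1{c(K) in B} 1{d(K, rho p) <= 1} over
   L(dK) and the Haar measure, Tonelli and the invariance of L give
     int 1{c(K) in B} v(K) L(dK) = V(B) L([B_1]) = L([B_1]),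
   hence gamma V(B_1) <= L([B_1]), which bounds gamma.  When gamma is finite, the
   disintegration of L and inversion invariance of the Haar measure give
   L([B_1]) = gamma E v(G). *)
Require Import Defs.
From HB Require Import structures.
From mathcomp Require Import all_boot all_order all_algebra.
From mathcomp Require Import all_classical all_reals all_analysis measurable_realfun.
From mathcomp Require Import ring lra.

Set Implicit Arguments.
Unset Strict Implicit.
Unset Printing Implicit Defensive.

Import Order.TTheory GRing.Theory Num.Theory.
Import numFieldNormedType.Exports.

Local Open Scope classical_set_scope.
Local Open Scope ring_scope.

(** * Isometries of the hyperboloid *)

Section hyperbolic_isometries.
Context {R : realType} {d : nat}.
Local Notation H := (hyperbolic_space R d).
Implicit Types (x y z : 'rV[R]_d.+1) (p q : H).

Lemma lorentzDl x y z (k : R) :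
  lorentz (x + k *: y) z = lorentz x z + k * lorentz y z.
Proof.
rewrite /lorentz !mxE mulrBr mulr_sumr.
under eq_bigr do rewrite !mxE mulrDl -mulrA.
by rewrite big_split /=; ring.
Qed.

Lemma lorentzDr x y z (k : R) :
  lorentz z (x + k *: y) = lorentz z x + k * lorentz z y.
Proof. by rewrite lorentzC lorentzDl !(lorentzC z). Qed.

Lemma lorentz_self p : lorentz (p : 'rV_d.+1) p = 1.
Proof. by have /andP[/eqP] := hyp_valP p. Qed.

(* If [y 0 0 <= 0], then [- y] lies on the upper sheet and
   [lorentz_ge1] applied to [- y] and [q] contradicts the hypothesis. *)
Lemma on_hyperboloid_pos y q :
  lorentz y y = 1 -> 0 < lorentz y q -> on_hyperboloid y.
Proof.
move=> yy yq; rewrite /on_hyperboloid yy eqxx/= ltNge; apply/negP => y0.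
have NE z z' : lorentz (- z) z' = - lorentz z z'.
  by rewrite -[- z]add0r -scaleN1r lorentzDl mulN1r /lorentz !mxE mul0r big1
    ?subr0 ?add0r// => i _; rewrite mxE mul0r.
have NyNy : lorentz (- y) (- y) = 1 by rewrite NE lorentzC NE opprK.
have Ny : on_hyperboloid (- y).
  rewrite /on_hyperboloid NyNy eqxx/= mxE oppr_gt0 lt_neqAle y0 andbT.
  apply/eqP => y00; move: yy; rewrite /lorentz y00 mul0r.
  have : 0 <= \sum_(i < d) y 0 (lift ord0 i) * y 0 (lift ord0 i).
    by apply: sumr_ge0 => i _; rewrite -expr2 sqr_ge0.
  by lra.
have := lorentz_ge1 (Hyperbolic Ny) q; rewrite /= NE; lra.
Qed.

(* Reflection [x - 2 <x,u>/<u,u> u] in the hyperplane orthogonal to [u = p - q],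
   where [lorentz u u = 2 - 2 * lorentz p q]; it is the identity if [p = q]. *)
Definition lreflect p q x : 'rV[R]_d.+1 :=
  x + (lorentz x ((p : 'rV_d.+1) + (-1) *: (q : 'rV_d.+1))
       / (lorentz p q - 1)) *: ((p : 'rV_d.+1) + (-1) *: (q : 'rV_d.+1)).

Lemma lreflectK p q : cancel (lreflect p q) (lreflect p q).
Proof.
move=> x; rewrite /lreflect; set u := (p : 'rV_d.+1) + _ *: (q : 'rV_d.+1).
set t := lorentz p q.
have uu : lorentz u u = 2 - 2 * t.
  rewrite /u lorentzDl !lorentzDr !lorentz_self (lorentzC q) -/t; ring.
clearbody u t; rewrite lorentzDl uu -addrA -scalerDl -mulrDl.
(* At [t = 1] the denominator [t - 1] vanishes, and the convention [0^-1 = 0] makes the reflection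
   coefficient zero. *)
have [->|t1] := eqVneq t 1; first by rewrite subrr invr0 !mulr0 scale0r addr0.
have t10 : t - 1 != 0 by rewrite subr_eq0.
rewrite (_ : (_ + _) / _ = 0) ?scale0r ?addr0//; field.
by [].
Qed.

Lemma lorentz_lreflect p q x y :
  lorentz (lreflect p q x) (lreflect p q y) = lorentz x y.
Proof.
rewrite /lreflect; set u := (p : 'rV_d.+1) + _ *: (q : 'rV_d.+1).
set t := lorentz p q.
have uu : lorentz u u = 2 - 2 * t.
  by rewrite /u lorentzDl !lorentzDr !lorentz_self (lorentzC q) -/t; ring.
clearbody u t; rewrite lorentzDl !lorentzDr uu (lorentzC u y).
have [->|t1] := eqVneq t 1; first by rewrite subrr invr0; ring.
have t10 : t - 1 != 0 by rewrite subr_eq0.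
field.
by [].
Qed.

Lemma lreflectE p q : lreflect p q p = q.
Proof.
rewrite /lreflect lorentzDr lorentz_self.
have [/lorentz_eq1 ->|t1] := eqVneq (lorentz p q) 1.
  by rewrite scaleN1r subrr scaler0 addr0.
have t10 : lorentz p q - 1 != 0 by rewrite subr_eq0.
rewrite (_ : _ / _ = -1); last by field.
by rewrite scalerDr !scaleN1r opprK addrA subrr add0r.
Qed.

(** The upper sheet is kept: [q] is the image of [p], so the form of the image of [r] with [q]
    equals [lorentz r p], which is at least 1. *)
Lemma on_hyperboloid_lreflect p q (r : H) : on_hyperboloid (lreflect p q r).
Proof.
apply: (@on_hyperboloid_pos _ q); first by rewrite lorentz_lreflect lorentz_self.
rewrite -[X in lorentz _ X](lreflectE p q) lorentz_lreflect.
exact: lt_le_trans (lorentz_ge1 _ _).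
Qed.

Definition hyp_reflect p q (r : H) : H := Hyperbolic (on_hyperboloid_lreflect p q r).

Lemma hyp_reflectK p q : cancel (hyp_reflect p q) (hyp_reflect p q).
Proof. by move=> r; apply: val_inj; rewrite /= lreflectK. Qed.

Lemma hyp_reflect_dist p q (r s : H) :
  mdist (hyp_reflect p q r) (hyp_reflect p q s) = mdist r s.
Proof. by rewrite /mdist/= /hyp_dist lorentz_lreflect. Qed.

Lemma isometry_transitive p q : exists f : isometry_group H, f p = q.
Proof.
exists (Isometry (hyp_reflectK p q) (hyp_reflectK p q) (hyp_reflect_dist p q)).
by apply: val_inj; rewrite /= lreflectE.
Qed.

End hyperbolic_isometries.

(** * Compactness and separability *)

Section metric_compactness.
Context {R : realType} {M : pmetricType R}.

Lemma open_mdist_ball (x : M) (e : R) : open [set y : M | mdist x y < e].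
Proof.
rewrite openE => y /= xy; apply/metricType_numDomainType.nbhs_mdistP.
exists (e - mdist x y) => /=; first by rewrite subr_gt0.
move=> z /= yz; have := metric_triangle x y z; lra.
Qed.

Lemma closed_cball (x : M) (e : R) : closed (cball x e).
Proof.
rewrite -[cball x e]setCK closedC openE => y /= /negP; rewrite -ltNge => xy.
apply/metricType_numDomainType.nbhs_mdistP.
exists (mdist x y - e) => /=; first by rewrite subr_gt0.
move=> z /= yz; apply/negP; rewrite -ltNge.
have := metric_triangle x z y; rewrite (metric_sym z); lra.
Qed.

Lemma compact_net (C : set M) (e : R) : compact C -> 0 < e ->
  exists s : seq M, forall y, C y -> exists2 x, x \in s & mdist x y < e.
Proof.
rewrite compact_cover => cC e0.
have [|y Cy|D _ CD] := cC M setT (fun x => [set y | mdist x y < e]).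
- by move=> x _; exact: open_mdist_ball.
- by exists y => //=; rewrite mdistxx.
- by exists (finmap.enum_fset D) => y /CD[x /= xD xy]; exists x.
Qed.

(** Finite nets of the closed balls of integer radius about [point], one for each precision
    [1/(m+1)], together form a countable dense set. *)
Lemma proper_separable : (forall (x : M) (r : R), compact (cball x r)) ->
  exists D : nat -> M, forall x (e : R), 0 < e -> exists n, mdist (D n) x < e.
Proof.
move=> cM.
have net (nm : nat * nat) : exists s : seq M,
    forall y, cball point nm.1%:R y -> exists2 x, x \in s & mdist x y < nm.2.+1%:R^-1.
  by apply: compact_net.
have [S HS] := choice net.
(* [k] codes a radius, a precision and a position in the corresponding net; numbers that code
   nothing and positions past the end give [point]. *)
exists (fun k => if @unpickle (nat * nat * nat)%type k is Some (nm, i)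
                 then nth point (S nm) i else point).
move=> x e e0.
have [m me] : exists m, m.+1%:R^-1 < e.
  exists (Num.truncn e^-1); rewrite invf_plt ?posrE//.
  exact: truncnS_gt.
have xb : cball point (Num.truncn (mdist point x)).+1%:R x.
  by rewrite /cball/= ltW// truncnS_gt.
have [y yS yx] := HS ((Num.truncn (mdist point x)).+1, m) x xb.
pose nm := ((Num.truncn (mdist point x)).+1, m).
exists (pickle (nm, index y (S nm))).
by rewrite pickleK nth_index// (lt_trans yx).
Qed.

End metric_compactness.

(** * The global chart of the hyperboloid and compactness of closed balls *)

Section hyperbolic_proper.
Context {R : realType} {d : nat}.
Local Notation H := (hyperbolic_space R d).
Implicit Types (v w : 'rV[R]_d) (p q : H).

(** The upper sheet is the graph of this time coordinate over the space coordinates [v]. *)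
Definition sheet_time v : R := Num.sqrt (1 + \sum_(i < d) v 0 i * v 0 i).

Definition sheet_vec v : 'rV[R]_d.+1 :=
  \row_j (if unlift ord0 j is Some i then v 0 i else sheet_time v).

Lemma lorentz_sheet v w : lorentz (sheet_vec v) (sheet_vec w) =
  sheet_time v * sheet_time w - \sum_(i < d) v 0 i * w 0 i.
Proof.
rewrite /lorentz !mxE unlift_none; congr (_ - _).
by apply: eq_bigr => i _; rewrite !mxE liftK.
Qed.

Lemma on_hyperboloid_sheet v : on_hyperboloid (sheet_vec v).
Proof.
have v0 : 0 <= \sum_(i < d) v 0 i * v 0 i.
  by apply: sumr_ge0 => i _; rewrite -expr2 sqr_ge0.
rewrite /on_hyperboloid lorentz_sheet mxE unlift_none -expr2 sqr_sqrtr; last by lra.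
by rewrite addrK eqxx/= sqrtr_gt0; lra.
Qed.

Definition sheet v : H := Hyperbolic (on_hyperboloid_sheet v).

Lemma sheet_surj p : sheet (\row_i (p : 'rV_d.+1) 0 (lift ord0 i)) = p.
Proof.
apply: val_inj; apply/rowP => j; rewrite mxE.
case: (unliftP ord0 j) => [i ->|->]; first by rewrite mxE.
have /andP[/eqP pp p0] := hyp_valP p.
rewrite /sheet_time; under eq_bigr do rewrite !mxE.
rewrite -{1}pp /lorentz subrK -expr2 sqrtr_sqr ger0_norm//.
exact: ltW.
Qed.

Lemma continuous_dot (T : topologicalType) n (f g : 'I_n -> T -> R) :
  (forall i, continuous (f i)) -> (forall i, continuous (g i)) ->
  continuous (fun x => \sum_(i < n) f i x * g i x).
Proof.
move=> cf cg x; apply: cvg_big => [|i _]; first exact: add_continuous.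
by apply: cvgM; [exact: cf|exact: cg].
Qed.

Lemma arcosh_cvg0 (T : topologicalType) (t : T -> R) x :
  {for x, continuous t} -> t x = 1 -> (arcosh (t y)) @[y --> x] --> (0 : R).
Proof.
move=> ct t1; have {}ct : t y @[y --> x] --> (1 : R) by rewrite -t1.
have cs : Num.sqrt (t y ^+ 2 - 1) @[y --> x] --> (0 : R).
  rewrite -[X in _ --> X](sqrtr0 R) -[X in Num.sqrt X](subrr (1 : R)).
  apply: (continuous_cvg _ (@sqrt_continuous R _)); apply: cvgB (cvg_cst _).
  by rewrite -[X in _ --> X](mulr1 1); under eq_cvg do rewrite expr2; exact: cvgM.
rewrite -(ln1 R) -[X in ln X](addr0 (1 : R)).
apply: continuous_cvg; first by rewrite addr0; exact: continuous_ln.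
exact: cvgD.
Qed.

Lemma sheet_time_continuous : continuous sheet_time.
Proof.
have sqrt1D (T : topologicalType) (f : T -> R) :
    continuous f -> continuous (fun x => Num.sqrt (1 + f x)).
  move=> cf x; apply: (continuous_cvg _ (@sqrt_continuous R _)).
  by apply: cvgD; [exact: cvg_cst|exact: cf].
apply: sqrt1D; apply: (@continuous_dot _ d (fun i (v : 'rV[R]_d) => v 0 i)
  (fun i (v : 'rV[R]_d) => v 0 i)) => i; exact: coord_continuous.
Qed.

(** Continuity at [x] compares [f y] with the fixed point [f x]: their form tends to 1, where
    [arcosh] tends to 0. *)
Lemma hyp_continuous (T : topologicalType) (f : T -> H) :
  (forall p, continuous (fun x => lorentz (p : 'rV_d.+1) (f x))) -> continuous f.
Proof.
move=> cf x; apply/metricType_numDomainType.cvgrPdist_lt => e e0.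
have := arcosh_cvg0 (cf (f x) x) (lorentz_self (f x)).
move=> /cvgrPdist_lt/(_ e e0); apply: filterS => w /=.
by rewrite sub0r normrN; apply: le_lt_trans; exact: ler_norm.
Qed.

Lemma sheet_continuous : continuous sheet.
Proof.
apply: hyp_continuous => p.
have MlB (T : topologicalType) (f g : T -> R) (a : R) :
    continuous f -> continuous g -> continuous (fun x => a * f x - g x).
  move=> cf cg x; apply: cvgB; last exact: cg.
  by apply: cvgM; [exact: cvg_cst|exact: cf].
rewrite -(sheet_surj p); under eq_fun do rewrite lorentz_sheet.
apply: MlB sheet_time_continuous _.
apply: (@continuous_dot _ d (fun i (w : 'rV[R]_d) => _)
  (fun i (w : 'rV[R]_d) => w 0 i)) => i; first exact: cst_continuous.
exact: coord_continuous.
Qed.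

(** The form of the origin [point] with [p] is the time coordinate of [p]; it is [cosh] of the
    distance, hence at most its exponential. The equation of the hyperboloid bounds each space
    coordinate by the time coordinate. *)
Lemma hyp_coord_le p i :
  `|(p : 'rV_d.+1) 0 (lift ord0 i)| <= expR (mdist (point : H) p).
Proof.
have /andP[/eqP pp p0] := hyp_valP p; have pg := lorentz_ge1 (point : H) p.
have pE : lorentz (\val (point : H)) p = (p : 'rV_d.+1) 0 0.
  rewrite /lorentz /= !mxE !eqxx mul1r big1 ?subr0// => k _.
  by rewrite !mxE/= mul0r.
have s0 := sqrtr_ge0 (lorentz (\val (point : H)) p ^+ 2 - 1).
have le1 : (p : 'rV_d.+1) 0 0 <= expR (mdist (point : H) p).
  rewrite /mdist/= /hyp_dist /arcosh lnK ?posrE; last by lra.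
  by rewrite -pE; lra.
apply: le_trans le1.
rewrite -(@ler_pXn2r _ 2)// ?nnegrE ?normr_ge0// ?ltW// real_normK ?num_real//.
move: pp; rewrite /lorentz (bigD1 i)//=.
have : 0 <= \sum_(j < d | j != i)
    (p : 'rV_d.+1) 0 (lift ord0 j) * (p : 'rV_d.+1) 0 (lift ord0 j).
  by apply: sumr_ge0 => k _; rewrite -expr2 sqr_ge0.
rewrite -!expr2; lra.
Qed.

Lemma compact_cball p (r : R) : compact (cball p r).
Proof.
(* Points of the ball are within [mdist point p + r] of the origin, so [hyp_coord_le] puts their
   space coordinates into the box [K]. *)
pose N := expR (mdist (point : H) p + r).
pose K := [set v : 'rV[R]_d | forall i, (`[- N, N]%classic : set R) (v ord0 i)].
have cK : compact K.
  by apply: (@rV_compact _ _ (fun=> `[- N, N]%classic)) => i; exact: segment_compact.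
apply: (@subclosed_compact _ _ (sheet @` K)); first exact: closed_cball.
  by apply: continuous_compact => //; apply/continuous_subspaceT/sheet_continuous.
move=> q; rewrite /cball/= => pq; exists (\row_i (q : 'rV_d.+1) 0 (lift ord0 i)).
  move=> i /=; rewrite mxE in_itv/= -ler_norml (le_trans (hyp_coord_le q i))//.
  rewrite ler_expR (le_trans (metric_triangle _ p _))//; lra.
exact: sheet_surj.
Qed.

Lemma hyp_separable : exists D : nat -> H, forall x (e : R), 0 < e ->
  exists n, mdist (D n) x < e.
Proof. by apply: proper_separable => x r; exact: compact_cball. Qed.

End hyperbolic_proper.

(** * Measurability *)

Section borel_measurability.
Context {R : realType}.

Lemma borel_measurable_open (T : ptopologicalType) (A : set T) :
  open A -> measurable (A : set (borel T)).
Proof. exact: sub_sigma_algebra. Qed.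

Lemma borel_measurable_closed (T : ptopologicalType) (A : set T) :
  closed A -> measurable (A : set (borel T)).
Proof.
move=> cA; rewrite -[A]setCK.
by apply: (@measurableC _ (borel T)); apply: borel_measurable_open; exact: closed_openC.
Qed.

Lemma continuous_borel_measurable (S T : ptopologicalType) (f : S -> T) :
  continuous f -> measurable_fun [set: borel S] (f : borel S -> borel T).
Proof.
move=> cf; apply: (@measurability _ _ _ _ _ (f : borel S -> borel T) open) => //.
move=> _ [B oB <-]; rewrite setTI; apply: borel_measurable_open.
by apply: open_comp => // x _; exact: cf.
Qed.

Lemma continuous_borel_measurable_real (S : ptopologicalType) (f : S -> R) :
  continuous f -> measurable_fun [set: borel S] (f : borel S -> R).
Proof.
move=> cf; apply: (measurability _ (RGenOInfty.measurableE R)) => //.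
move=> _ [_ [x ->] <-]; rewrite setTI; apply: borel_measurable_open.
by apply: open_comp => [y _|]; [exact: cf|exact: interval_open].
Qed.

Lemma open_mdist (N : metricType R) (A : set N) :
  (forall x, A x -> exists2 e : R, 0 < e & forall y, mdist x y < e -> A y) ->
  open A.
Proof.
move=> hA; rewrite openE => x /hA[e e0 eA].
by apply/metricType_numDomainType.nbhs_mdistP; exists e.
Qed.

Context {M : pmetricType R}.

Lemma lipschitz1_continuous (N : metricType R) (f : N -> R) :
  (forall x y, f x <= f y + mdist x y) -> continuous f.
Proof.
move=> lf x; apply/cvgrPdist_lt => e e0; apply/metricType_numDomainType.nbhs_mdistP.
exists e => //= y /= xy; have := lf x y; have := lf y x.
rewrite (metric_sym y) ltr_norml => ? ?.
by apply/andP; split; lra.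
Qed.

Lemma mdist_continuous (x : M) : continuous (mdist x).
Proof.
by apply: lipschitz1_continuous => y z; rewrite (metric_sym y) metric_triangle.
Qed.

(* The superlevel sets of a function that is 1-Lipschitz in its second variable
   are countable unions, over a dense sequence, of measurable sets. *)
Lemma measurable_lipschitz_le (D : nat -> M) {dT} {T : measurableType dT}
    (g : T -> M -> R) (r : R) :
  (forall x (e : R), 0 < e -> exists n, mdist (D n) x < e) ->
  (forall x, measurable_fun setT (g^~ x)) ->
  (forall t x y, g t x <= g t y + mdist x y) ->
  measurable [set z : T * borel M | g z.1 z.2 <= r].
Proof.
move=> dD mg lg.
rewrite (_ : mkset _ = ~` \bigcup_n
    ((fun z : T * borel M => g z.1 (D n) - mdist (D n) z.2) @^-1` `]r, +oo[)).
  apply/measurableC/bigcup_measurable => n _; rewrite -[X in measurable X]setTI.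
  apply: measurable_funB => //.
    by apply: (measurableT_comp (mg (D n))); exact: measurable_fst.
  apply: (@measurableT_comp _ _ _ _ _ _ (mdist (D n) : borel M -> R)).
    by apply: continuous_borel_measurable_real; exact: mdist_continuous.
  exact: measurable_snd.
apply/seteqP; split => -[t x] /= => [gr [n _ /=]|nr].
  by rewrite in_itv/= andbT; have := lg t (D n) x; lra.
rewrite leNgt; apply/negP => rg; apply: nr.
(* The distance from [x] to [D n] is lost twice, by the Lipschitz bound and by the subtracted term;
   hence half the gap. *)
have [n nx] := dD x ((g t x - r) / 2) ltac:(lra).
exists n => //=; rewrite in_itv/= andbT.
by have := lg t x (D n); rewrite (metric_sym x); lra.
Qed.

Lemma dist_set_lip_particle (x : M) (K L : particle M) :
  dist_set K x <= dist_set L x + mdist K L.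
Proof.
have LK : excess L K <= mdist K L by rewrite /mdist/= /hausdorff_dist le_max lexx orbT.
rewrite (le_trans _ (lerD (lexx _) LK))//.
apply/ler_addgt0Pr => e e0.
have [a La ax] := dist_set_approx x (particle_neq0 L) e0.
have := dist_set_lip x a (particle_neq0 K); have := excess_ub K La; lra.
Qed.

Lemma dist_set_particle_continuous (x : M) :
  continuous (fun K : particle M => dist_set K x).
Proof.
by apply: lipschitz1_continuous => K L; exact: dist_set_lip_particle.
Qed.

Lemma particle_dist_attained (K : particle M) (x : M) :
  exists2 a, pset_of K a & mdist a x = dist_set K x.
Proof.
have [a Ka ha] := compact_EVT_min (particle_neq0 K) (@particle_compact _ _ K)
  (continuous_subspaceT (@mdist_continuous x)).
rewrite inE in Ka; exists a => //; apply/eqP; rewrite eq_le dist_set_le// andbT.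
apply: lb_le_inf; first by exists (mdist a x), a.
by move=> _ [b Kb <-]; rewrite !(metric_sym _ x); apply: ha; rewrite inE.
Qed.

Lemma hitting_cball (x : M) (r : R) :
  hitting (cball x r) = [set K : particle M | dist_set K x <= r].
Proof.
apply/seteqP; split => K.
  move=> [y [Ky xy]] /=; apply: le_trans (dist_set_le x Ky) _.
  by rewrite metric_sym.
move=> /= Kx; have [a Ka ax] := particle_dist_attained K x.
by exists a; split => //; rewrite /cball/= metric_sym ax.
Qed.

(** If [K] misses a nonempty [C], its distance function has a positive minimum on [C], and a
    particle closer to [K] than this minimum in the Hausdorff metric misses [C] too. *)
Lemma closed_hitting (C : set M) : compact C -> closed (hitting C : set (particle M)).
Proof.
move=> cC; have [C0|/set0P/negP/negPn/eqP ->] := pselect (C !=set0); last first.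
  rewrite (_ : hitting _ = set0); first exact: closed0.
  by apply/seteqP; split => K // [y []].
rewrite -[hitting C]setCK closedC; apply: open_mdist => K KC.
have [a Ca ha] := compact_EVT_min C0 cC
  (continuous_subspaceT (@dist_set_continuous _ _ _ (particle_neq0 K))).
rewrite inE in Ca.
have e0 : 0 < dist_set K a.
  rewrite lt_neqAle dist_set_ge0 andbT; apply/eqP => Ka0.
  have [b Kb ba] := particle_dist_attained K a.
  apply: KC; exists a; split => //; move: ba; rewrite -Ka0.
  by move=> /mdist_positivity <-.
exists (dist_set K a) => // L KL.
move=> [y [Ly Cy]]; have := dist_set_lip_particle y K L.
rewrite (_ : dist_set L y = 0); last first.
  by apply/eqP; rewrite eq_le dist_set_ge0 andbT -(mdistxx y) dist_set_le.
have := ha y; rewrite inE => /(_ Cy); lra.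
Qed.

(** These sets are pullbacks of subbasic sets of the compact-open topology. *)
Lemma isom_image_sub_open (K O : set M) : compact K -> open O ->
  open [set f : isometry_group M | f @` K `<=` O].
Proof.
move=> cK oO; pose W : set {compact-open, M -> M} := [set g | g @` K `<=` O].
have oW : open W by exact: compact_open_open.
move: (@initial_continuous (isometry_group M) {compact-open, M -> M}
  (@isom_fun R M)) => /continuousP/(_ W oW); exact.
Qed.

Lemma isom_eval_continuous (x : M) :
  continuous (fun f : isometry_group M => f x).
Proof.
apply/continuousP => O oO.
rewrite (_ : _ @^-1` O = [set f : isometry_group M | f @` [set x] `<=` O]).
  by apply: (isom_image_sub_open (@compact_set1 _ x)) oO.
by apply/seteqP; split => f /=; rewrite image_set1 => h; [move=> _ ->|exact: h].
Qed.

Lemma closed_isom_hitting (K : particle M) (C : set M) : closed C ->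
  closed [set f : isometry_group M | hitting C (isom_act f K)].
Proof.
move=> cC; rewrite -[X in closed X]setCK closedC.
rewrite (_ : ~` _ = [set f : isometry_group M | f @` pset_of K `<=` ~` C]).
  by apply: isom_image_sub_open; [exact: particle_compact|exact: closed_openC].
apply/seteqP; split => f /= h.
  by move=> y fKy Cy; apply: h; exists y.
by move=> [y [fKy Cy]]; exact: h fKy Cy.
Qed.

End borel_measurability.

(** * Finite covers and Tonelli's theorem for sections *)

Section measure_lemmas.
Local Open Scope ereal_scope.
Context {R : realType}.

Lemma measure_finite_cover {dT} {T : measurableType dT}
    (mu : {measure set T -> \bar R}) (I : eqType) (s : seq I) (F : I -> set T)
    (A : set T) :
  measurable A -> (forall i, i \in s -> measurable (F i)) ->
  A `<=` [set x | exists2 i, i \in s & F i x] ->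
  mu A <= \sum_(i <- s) mu (F i).
Proof.
move=> mA; elim: s A mA => [|i s IH] A mA mF AF.
  rewrite big_nil (_ : A = set0) ?measure0//.
  by apply/seteqP; split => // x /AF[].
have mi : measurable (F i) by apply: mF; rewrite mem_head.
rewrite big_cons (le_trans (le_measure mu _ _ _ : _ <= mu (F i `|` (A `\` F i)))) ?inE//.
- by apply: measurableU => //; exact: measurableD.
- by move=> x Ax; have [|] := pselect (F i x); [left|right].
apply: le_trans (measureU2 _ _ _) _ => //; first exact: measurableD.
rewrite leeD2l//; apply: IH; first exact: measurableD.
  by move=> j js; apply: mF; rewrite in_cons js orbT.
move=> x [/AF[j]]; rewrite in_cons => /orP[/eqP ->//|js] Fj _.
by exists j.
Qed.

(** Sigma-finiteness is proved below as a property of given measures, while Fubini-Tonelli speaks of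
    bundled sigma-finite measures; this passes from one to the other. *)
Lemma sigma_finite_measure_pack {dT} {T : measurableType dT}
    (mu : {measure set T -> \bar R}) : sigma_finite setT mu ->
  exists nu : {sigma_finite_measure set T -> \bar R}, mu = nu.
Proof.
move=> fmu; pose H1 := isSFinite.Build _ _ _ _ (sfinite_measure_sigma_finite fmu).
pose H2 := isSigmaFinite.Build _ _ _ _ fmu.
pose nu := HB.pack_for (SigmaFiniteMeasure.type T R) (Measure.sort mu) H1 H2.
by exists nu; exact: eq_measure.
Qed.

(** This is Tonelli's theorem for the indicator of [A], with the inner integrals written as measures
    of sections. *)
Lemma tonelli_sections {d1 d2} {T1 : measurableType d1} {T2 : measurableType d2}
    (m1 : {measure set T1 -> \bar R}) (m2 : {measure set T2 -> \bar R})
    (A : set (T1 * T2)) :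
  sigma_finite setT m1 -> sigma_finite setT m2 -> measurable A ->
  \int[m1]_x m2 [set y | A (x, y)] = \int[m2]_y m1 [set x | A (x, y)].
Proof.
move=> /sigma_finite_measure_pack[n1 ->] /sigma_finite_measure_pack[n2 ->] mA.
have := indic_fubini_tonelli n1 n2 mA.
rewrite indic_fubini_tonelli_FE// indic_fubini_tonelli_GE// => h.
rewrite [LHS](_ : _ = \int[n1]_x (n2 \o xsection A) x); last first.
  by apply: eq_integral => x _; rewrite /comp xsectionE.
by rewrite h; apply: eq_integral => y _; rewrite /comp ysectionE.
Qed.

Lemma measurable_fun_measure_xsection {d1 d2} {T1 : measurableType d1}
    {T2 : measurableType d2} (m2 : {measure set T2 -> \bar R}) (A : set (T1 * T2)) :
  sigma_finite setT m2 -> measurable A ->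
  measurable_fun setT (fun x => m2 [set y | A (x, y)]).
Proof.
move=> /sigma_finite_measure_pack[n2 ->] mA.
rewrite [X in measurable_fun _ X](_ : _ = n2 \o xsection A); last first.
  by apply/funext => x; rewrite /comp xsectionE.
exact: measurable_fun_xsection.
Qed.

Lemma measurable_fun_measure_ysection {d1 d2} {T1 : measurableType d1}
    {T2 : measurableType d2} (m1 : {measure set T1 -> \bar R}) (A : set (T1 * T2)) :
  sigma_finite setT m1 -> measurable A ->
  measurable_fun setT (fun y => m1 [set x | A (x, y)]).
Proof.
move=> /sigma_finite_measure_pack[n1 ->] mA.
rewrite [X in measurable_fun _ X](_ : _ = n1 \o ysection A); last first.
  by apply/funext => x; rewrite /comp ysectionE.
exact: measurable_fun_ysection.
Qed.

Lemma measurable_section_fst {d1 d2} {T1 : measurableType d1} {T2 : measurableType d2}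
  (A : set (T1 * T2)) x : measurable A -> measurable [set y | A (x, y)].
Proof. by move=> /(measurable_xsection x); rewrite xsectionE. Qed.

Lemma measurable_preimage_pair {dS d1 d2} {S : measurableType dS}
    {T1 : measurableType d1} {T2 : measurableType d2} (f : S -> T1) (g : S -> T2)
    (A : set (T1 * T2)) :
  measurable_fun setT f -> measurable_fun setT g -> measurable A ->
  measurable [set x | A (f x, g x)].
Proof.
move=> mf mg mA; rewrite -[X in measurable X]setTI.
exact: (measurable_fun_pair mf mg) mA.
Qed.

End measure_lemmas.

Section hyperbolic_measurability.
Context {R : realType} {d : nat}.
Local Notation H := (hyperbolic_space R d).

(** Tonelli needs measurability for the product of the two Borel sigma-algebras; it comes from the
    Lipschitz bound in the point, along a dense sequence. *)
Lemma measurable_particle_dist (r : R) :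
  measurable [set z : borel (particle H) * borel H |
    dist_set (z.1 : particle H) z.2 <= r].
Proof.
have [D dD] := @hyp_separable R d.
apply: (measurable_lipschitz_le
  (g := fun K : borel (particle H) => dist_set (K : particle H)) r dD).
  move=> x; apply: continuous_borel_measurable_real.
  exact: dist_set_particle_continuous.
move=> K x y; rewrite metric_sym; apply: dist_set_lip; exact: particle_neq0.
Qed.

Lemma measurable_isom_dist (b : H) (r : R) :
  measurable [set z : borel (isometry_group H) * borel H |
    mdist b ((z.1 : isometry_group H) z.2) <= r].
Proof.
have [D dD] := @hyp_separable R d.
apply: (measurable_lipschitz_le
  (g := fun (f : borel (isometry_group H)) x => mdist b ((f : isometry_group H) x)) r dD).
  move=> x; apply: continuous_borel_measurable_real => f.
  apply: (continuous_comp (@isom_eval_continuous _ _ x f)).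
  exact: mdist_continuous.
by move=> f x y; rewrite -(isom_dist f x y) (metric_sym (f x)) metric_triangle.
Qed.

Lemma measurable_isom_eval (x : H) (A : set (borel H)) : measurable A ->
  measurable [set f : borel (isometry_group H) | A ((f : isometry_group H) x)].
Proof.
move=> mA; rewrite -[X in measurable X]setTI.
by apply: (continuous_borel_measurable (@isom_eval_continuous _ _ x)).
Qed.

Lemma measurable_cball (x : H) (r : R) : measurable (cball x r : set (borel H)).
Proof. by apply: borel_measurable_closed; exact: closed_cball. Qed.

Lemma measurable_hitting (C : set H) : compact C ->
  measurable (hitting C : set (borel (particle H))).
Proof. by move=> cC; apply: borel_measurable_closed; exact: closed_hitting. Qed.

Lemma measurable_parallel_set (K : particle H) (r : R) :
  measurable (parallel_set K r : set (borel H)).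
Proof. exact: measurable_section_fst (measurable_particle_dist r). Qed.

End hyperbolic_measurability.

(** * Volume and Haar measure *)

Section invariant_volume.
Local Open Scope ereal_scope.
Context {R : realType} {d : nat}.
Local Notation H := (hyperbolic_space R d).
Local Notation I := (isometry_group H).

(** The constant cover by [A] has diameter 0, and the power [d > 0] of 0 vanishes. *)
Lemma volume_le_singleton (b : H) (A : set H) :
  (0 < d)%N -> A `<=` [set b] -> volume A <= 0.
Proof.
move=> d_gt0 Ab; apply: ge_ereal_sup => _ [e /= e0 <-].
have dA : diam A = 0.
  apply/eqP; rewrite eq_le; apply/andP; split; last by rewrite /diam le_max lexx.
  rewrite /diam ge_max lexx/=; apply: ge_ereal_sup => _ [x /Ab -> [y /Ab -> <-]].
  by rewrite mdistxx.
apply: ereal_inf_lbound; exists (fun=> A); first split.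
- by move=> x Ax; exists 0%N.
- by move=> i; rewrite dA lee_fin ltW.
- by rewrite eseries0// => i _ _; rewrite dA -(prednK d_gt0) expeS mul0e mule0.
Qed.

Context (lambda : {measure set (borel I) -> \bar R}).
Hypotheses (haar_lambda : haar_measure lambda) (norm_lambda : haar_normalized lambda).

(** The normalization writes volumes of Borel sets as Haar measures, so that [volume] inherits
    monotonicity, invariance and covering bounds from [lambda]. *)
Lemma volumeE (x : H) (A : set (borel H)) : measurable A ->
  volume A = lambda [set f : borel I | A ((f : I) x)].
Proof.
move=> mA.
transitivity (\int[lambda]_f (\1_[set f : borel I | A ((f : I) x)] f)%:E).
  exact: norm_lambda.
by rewrite integral_indic ?setIT//; exact: measurable_isom_eval.
Qed.

Lemma volumeE_inv (x : H) (A : set (borel H)) : measurable A ->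
  lambda [set f : borel I | A (isom_inv (f : I) x)] = volume A.
Proof.
move=> mA; have [_ _ inv _] := haar_lambda; rewrite (volumeE x mA) -[RHS]inv//.
exact: measurable_isom_eval.
Qed.

(** Left composition with [f] turns evaluation at [point] into evaluation followed by [f], so left
    invariance of the Haar measure applies. *)
Lemma volume_isom (f : I) (A : set (borel H)) : measurable A ->
  volume (f @^-1` A) = volume A.
Proof.
move=> mA; have mfA : measurable (f @^-1` A : set (borel H)).
  rewrite -[X in measurable X]setTI.
  by apply: (continuous_borel_measurable (@isom_continuous _ _ f)).
have [linv _ _ _] := haar_lambda.
rewrite (volumeE point mfA) (volumeE point mA) -[RHS](linv f)//.
exact: measurable_isom_eval.
Qed.

Lemma volume_le (A B : set (borel H)) : measurable A -> measurable B ->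
  A `<=` B -> volume A <= volume B.
Proof.
move=> mA mB AB; rewrite (volumeE point mA) (volumeE point mB).
apply: le_measure; rewrite ?inE; [exact: measurable_isom_eval..|].
by move=> f /AB.
Qed.

Lemma preimage_isom_cball (f : I) (x : H) (r : R) : f @^-1` cball (f x) r = cball x r.
Proof. by apply/seteqP; split => y; rewrite /cball/= isom_dist. Qed.

Lemma volume_cball (x y : H) (r : R) : volume (cball x r) = volume (cball y r).
Proof.
have [f <-] := isometry_transitive x y.
by rewrite -(volume_isom f (measurable_cball (f x) r)) preimage_isom_cball.
Qed.

Lemma volume_cover (x : H) (r e : R) : (0 < e)%R ->
  exists s : seq H, volume (cball x r) <= \sum_(y <- s) volume (cball y e).
Proof.
move=> e0; have [s hs] := compact_net (@compact_cball _ _ x r) e0.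
exists s; rewrite (volumeE point (measurable_cball _ _)).
under eq_bigr do rewrite (volumeE point (measurable_cball _ _)).
apply: measure_finite_cover => [|y _|f /hs[y ys yf]].
- exact: @measurable_isom_eval _ _ point _ (measurable_cball x r).
- exact: @measurable_isom_eval _ _ point _ (measurable_cball y e).
- by exists y => //; exact: ltW.
Qed.

Context (b : H) (r : R).
Hypotheses (d_gt0 : (0 < d)%N) (vol_br : volume (cball b r) = 1).

(** A ball of radius at most 0 lies in a single point and would have volume 0 instead of 1. *)
Lemma unit_ball_radius_gt0 : (0 < r)%R.
Proof.
rewrite ltNge; apply/negP => r0; suff : volume (cball b r) <= 0.
  by rewrite vol_br lee_fin ler10.
apply: (@volume_le_singleton b) => // y /= by_.
apply/esym/mdist_positivity/eqP.
by rewrite eq_le mdist_ge0 andbT (le_trans by_).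
Qed.

(** Finitely many balls of radius [r], each of volume 1, cover any given ball. *)
Lemma volume_cball_fin (x : H) (e : R) : volume (cball x e) < +oo.
Proof.
have [s] := volume_cover x e unit_ball_radius_gt0.
move=> /le_lt_trans; apply; apply: lte_sum_pinfty => y _.
by rewrite (volume_cball y b) vol_br ltry.
Qed.

(** Finitely many balls of radius [e], all of the same volume, cover the ball of volume 1, so this
    common volume cannot vanish. *)
Lemma volume_cball_gt0 (x : H) (e : R) : (0 < e)%R -> 0 < volume (cball x e).
Proof.
move=> e0; rewrite lt_neqAle (volumeE point (measurable_cball x e)) measure_ge0 andbT.
rewrite -(volumeE point (measurable_cball x e)); apply/eqP => v0.
have [s] := volume_cover b r e0; rewrite big1 ?vol_br ?lee_fin ?ler10// => y _.
by rewrite (volume_cball y x).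
Qed.

(** The isometries moving [point] by at most [n] exhaust the group, and their Haar measure is the
    volume of a ball. *)
Lemma sigma_finite_haar : sigma_finite setT lambda.
Proof.
exists (fun n => [set f : borel I | cball point n%:R ((f : I) point)]).
  apply/seteqP; split => // f _; exists (Num.truncn (mdist point (f point))).+1 => //=.
  by rewrite /cball/= ltW// truncnS_gt.
move=> n; split; first exact: @measurable_isom_eval _ _ point _ (measurable_cball _ _).
by rewrite -(volumeE _ (measurable_cball _ _)) volume_cball_fin.
Qed.

(* Inversion invariance turns [rho K] meeting a ball around [x] into
   [rho x] being close to [K]. *)
Lemma haar_hitting_cball (x : H) (e : R) (K : particle H) :
  lambda [set f : borel I | hitting (cball x e) (isom_act (f : I) K)] =
  volume (parallel_set K e).
Proof.
rewrite -(volumeE_inv x (measurable_parallel_set K e)); congr (lambda _).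
rewrite hitting_cball; apply/seteqP; split => f /=.
  by rewrite -{1}(isom_invK f x) dist_set_isom.
by rewrite -{2}(isom_invK f x) dist_set_isom.
Qed.

End invariant_volume.

(** * Intensity measures of stationary particle processes *)

Section stationary_intensity.
Local Open Scope ereal_scope.
Context {R : realType} {d : nat}.
Local Notation H := (hyperbolic_space R d).
Local Notation I := (isometry_group H).
Local Notation Cd := (borel (particle H)).
Context {dO : measure_display} {Omega : measurableType dO}.
Context (P : probability Omega R) (zeta : R.-ker Omega ~> Cd).
Hypothesis zeta_stationary : stationary P zeta.
Local Notation Lambda := (intensity_measure P zeta).

Lemma intensity_measure_isom (f : I) (A : set Cd) : measurable A ->
  Lambda (particle_act f @^-1` A) = Lambda A.
Proof.
move=> mA; have mfA : measurable (particle_act f @^-1` A).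
  by rewrite -[X in measurable X]setTI; exact: measurable_funPT.
rewrite /intensity_measure.
(* Stationarity compares probabilities of events, so each expectation becomes an integral against
   the law of [zeta w B]. The absolute value makes the integrand nonnegative on the whole extended
   line. *)
have pushE (B : set Cd) : measurable B ->
    \int[P]_w zeta w B = \int[pushforward P (fun w => zeta w B)]_y `|y|.
  move=> mB; rewrite ge0_integral_pushforward//; last exact: measurable_kernel.
  by apply: eq_integral => w _ /=; rewrite gee0_abs.
rewrite !pushE//; apply: eq_measure_integral => [||? ? B mB _];
  [exact: measurable_kernel..|].
have := @zeta_stationary f [set mu | B (mu A)]; apply.
apply: sub_sigma_algebra; exists A => //; exists B => //.
by rewrite setTI.
Qed.

Lemma hitting_particle_act (f : I) (C : set H) :
  particle_act f @^-1` hitting C = hitting (f @^-1` C).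
Proof.
apply/seteqP; split => K /=.
  by move=> [_ [[y Ky <-] Cy]]; exists y.
by move=> [y [Ky Cy]]; exists (f y); split => //; exists y.
Qed.

Lemma intensity_hitting_cball (x y : H) (r : R) :
  Lambda (hitting (cball x r)) = Lambda (hitting (cball y r)).
Proof.
have [f <-] := isometry_transitive x y.
rewrite -(intensity_measure_isom f (measurable_hitting (@compact_cball _ _ (f x) r))).
by rewrite hitting_particle_act preimage_isom_cball.
Qed.

Lemma intensity_measure_le (A B : set Cd) : measurable A -> measurable B ->
  A `<=` B -> Lambda A <= Lambda B.
Proof. by move=> mA mB AB; apply: le_measure; rewrite ?inE. Qed.

Lemma intensity_hitting_fin (C0 C : set H) :
  compact C0 -> interior C0 !=set0 -> Lambda (hitting C0) < +oo ->
  compact C -> Lambda (hitting C) < +oo.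
Proof.
move=> cC0 [x /metricType_numDomainType.nbhs_mdistP[e /= e0 xC0]] C0oo cC.
(* Closed balls of half the radius cover [C], and their isometric copy about [x] fits into the open
   ball inside [C0]. *)
have e20 : (0 < e / 2)%R by rewrite divr_gt0.
have [s hs] := compact_net cC e20.
apply: (@le_lt_trans _ _ (\sum_(y <- s) Lambda (hitting (cball y (e / 2))))).
  apply: measure_finite_cover => [|y _|K [z [Kz /hs[y ys yz]]]].
  - exact: measurable_hitting.
  - exact: measurable_hitting (@compact_cball _ _ _ _).
  - by exists y => //; exists z; split => //; exact: ltW.
apply: lte_sum_pinfty => y _; rewrite (intensity_hitting_cball y x).
apply: le_lt_trans C0oo; apply: intensity_measure_le.
- exact: measurable_hitting (@compact_cball _ _ _ _).
- exact: measurable_hitting.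
- move=> K [z [Kz xz]]; exists z; split => //; apply: xC0 => /=.
  by rewrite (le_lt_trans xz)// ltr_pdivrMr// ltr_pMr// ltr1n.
Qed.

(** Every particle hits some ball of integer radius about [point], and finiteness for one ball of
    positive radius spreads to all of them. *)
Lemma sigma_finite_intensity (p : H) (r : R) : (0 < r)%R ->
  Lambda (hitting (cball p r)) < +oo -> sigma_finite setT Lambda.
Proof.
move=> r0 fin; exists (fun n => hitting (cball point n%:R)).
  apply/seteqP; split => // K _; have [y Ky] := particle_neq0 K.
  exists (Num.truncn (mdist point y)).+1 => //=; exists y; split => //.
  by rewrite /cball/= ltW// truncnS_gt.
move=> n; split; first exact: measurable_hitting (@compact_cball _ _ _ _).
apply: (intensity_hitting_fin _ _ fin); [exact: compact_cball| |exact: compact_cball].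
exists p; apply: (filterS _ (nbhsx_ballx p _ r0)) => z.
by rewrite ballEmdist => /ltW.
Qed.

End stationary_intensity.

(** * Mass transport between particles and isometries *)

Section mass_transport.
Local Open Scope ereal_scope.
Context {R : realType} {d : nat}.
Local Notation H := (hyperbolic_space R d).
Local Notation I := (isometry_group H).
Local Notation Cd := (borel (particle H)).
Context {dO : measure_display} {Omega : measurableType dO}.
Context (P : probability Omega R) (zeta : R.-ker Omega ~> Cd).
Local Notation Lambda := (intensity_measure P zeta).
Context (lambda : {measure set (borel I) -> \bar R}).
Hypotheses (haar_lambda : haar_measure lambda) (norm_lambda : haar_normalized lambda).
Context (b : H) (r : R).
Hypotheses (d_gt0 : (0 < d)%N) (vol_br : volume (cball b r) = 1).

Lemma measurable_particle_isom_dist (x : H) (e : R) : measurable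
  [set z : Cd * borel I | (dist_set (z.1 : particle H) ((z.2 : I) x) <= e)%R].
Proof.
apply: (measurable_preimage_pair (f := fst)
  (g := fun z : Cd * borel I => (z.2 : I) x : borel H) _ _ (measurable_particle_dist e)).
  exact: measurable_fst.
apply: (measurableT_comp (continuous_borel_measurable (@isom_eval_continuous _ _ x))).
exact: measurable_snd.
Qed.

Lemma measurable_volume_parallel_set (e : R) :
  measurable_fun setT (fun K : Cd => volume (parallel_set (K : particle H) e)).
Proof.
have := measurable_fun_measure_xsection
  (sigma_finite_haar haar_lambda norm_lambda d_gt0 vol_br)
  (measurable_particle_isom_dist point e).
apply: eq_measurable_fun => K _.
by rewrite (volumeE norm_lambda point (measurable_parallel_set K e)).
Qed.

Context (c : Cd -> borel H).
Hypothesis c_center : center_function c.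

Lemma intensityE (B : set (borel H)) : measurable B ->
  intensity P zeta c B = Lambda (c @^-1` B).
Proof.
move=> mB; have [mc _] := c_center.
have mcB : measurable (c @^-1` B) by rewrite -[X in measurable X]setTI; exact: mc.
by rewrite -[X in _ = Lambda X]setIT -integral_indic.
Qed.

(** The disintegration of [Lambda] is evaluated on the hitting set; for each particle the inner Haar
    integral is given by [haar_hitting_cball]. *)
Lemma typical_hitting (p : H) (gamma : \bar R) (Q : probability Cd R) (e : R) :
  typical_distribution P zeta p lambda c gamma Q ->
  Lambda (hitting (cball p e)) =
  gamma * \int[Q]_K volume (parallel_set (K : particle H) e).
Proof.
have mh := measurable_hitting (@compact_cball _ _ p e).
move=> [_ _ ->//]; congr (_ * _); apply: eq_integral => K _.
rewrite -(haar_hitting_cball haar_lambda norm_lambda p e K).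
transitivity (\int[lambda]_f
    (\1_[set f : borel I | hitting (cball p e) (isom_act (f : I) K)] f)%:E) => //.
rewrite integral_indic ?setIT//; apply: borel_measurable_closed.
exact: (@closed_isom_hitting _ _ (K : particle H) _ (@closed_cball _ _ p e)).
Qed.

Hypothesis zeta_stationary : stationary P zeta.

Lemma intensity_volume_le (p : H) : Lambda (hitting (cball p 1%R)) < +oo ->
  intensity P zeta c (cball b r) * volume (cball p 1%R) <= Lambda (hitting (cball p 1%R)).
Proof.
move=> fin; have [mc cE] := c_center.
have sL := sigma_finite_intensity zeta_stationary ltr01 fin.
have sl := sigma_finite_haar haar_lambda norm_lambda d_gt0 vol_br.
(* [A2] is [A1] with [K] replaced by its image under [f]: the center function is equivariant, and
   the image is as far from [f p] as [K] is from [p]. *)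
pose A1 := [set z : borel I * Cd | cball b r (c z.2) /\
  (dist_set (z.2 : particle H) ((z.1 : I) p) <= 1)%R].
pose A2 := [set z : borel I * Cd | cball b r ((z.1 : I) (c z.2)) /\
  (dist_set (z.2 : particle H) p <= 1)%R].
have mev x : measurable_fun setT (fun z : borel I * Cd => (z.1 : I) x : borel H).
  apply: (measurableT_comp (continuous_borel_measurable (@isom_eval_continuous _ _ x))).
  exact: measurable_fst.
have mc2 : measurable_fun setT (fun z : borel I * Cd => c z.2).
  by apply: (measurableT_comp mc); exact: measurable_snd.
have mA1 : measurable A1.
  apply: measurableI.
    by rewrite -[X in measurable X]setTI; apply: mc2 => //; exact: measurable_cball.
  exact: measurable_preimage_pair measurable_snd (mev p) (measurable_particle_dist 1).
have mA2 : measurable A2.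
  apply: measurableI.
    exact: measurable_preimage_pair measurable_fst mc2 (measurable_isom_dist b r).
  rewrite -[X in measurable X]setTI.
  apply: (@measurable_snd _ _ (borel I) Cd measurableT
    [set K : Cd | (dist_set (K : particle H) p <= 1)%R]).
  by rewrite -hitting_cball; exact: measurable_hitting (@compact_cball _ _ _ _).
have mB : measurable (c @^-1` cball b r).
  by rewrite -[X in measurable X]setTI; apply: mc => //; exact: measurable_cball.
rewrite (intensityE (measurable_cball b r)) muleC -integral_cst//.
have mlA1 : measurable_fun setT (fun K => lambda [set f | A1 (f, K)]).
  exact: measurable_fun_measure_ysection.
apply: (@le_trans _ _ (\int[Lambda]_K lambda [set f | A1 (f, K)])).
  apply: (@le_trans _ _
    (\int[Lambda]_(K in c @^-1` cball b r) lambda [set f | A1 (f, K)])).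
    apply: ge0_le_integral => //; [|exact: measurable_funTS|].
      move=> K _; apply/ltW.
      exact: (volume_cball_gt0 haar_lambda norm_lambda vol_br p ltr01).
    (* The parallel set contains the unit ball about any point [a] of [K], whose volume equals that
       of the unit ball about [p]. *)
    move=> K cKb; have [a Ka] := particle_neq0 (K : particle H).
    rewrite (volume_cball haar_lambda norm_lambda p a).
    rewrite (_ : [set f | _] = [set f | parallel_set (K : particle H) 1 ((f : I) p)]).
      rewrite -(volumeE norm_lambda p (measurable_parallel_set _ _)).
      apply: (volume_le norm_lambda) => [||y ay].
      - exact: measurable_cball.
      - exact: measurable_parallel_set.
      - exact: le_trans (dist_set_le y Ka) ay.
    by apply/seteqP; split => f; [case|split].
  exact: ge0_subset_integral.
rewrite -(tonelli_sections sl sL mA1).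
(* Invariance of [Lambda] applies for each fixed [f]; hence one use of Tonelli before the change
   from [A1] to [A2] and one after it. *)
have A12 f : Lambda [set K | A1 (f, K)] = Lambda [set K | A2 (f, K)].
  have := intensity_measure_isom zeta_stationary f (measurable_section_fst f mA1).
  move=> <-; congr (Lambda _); apply/seteqP.
  by split => K; rewrite /A1 /A2 /= cE dist_set_isom.
rewrite (eq_integral (fun f => Lambda [set K | A2 (f, K)])); last first.
  by move=> f _; exact: A12.
rewrite (tonelli_sections sl sL mA2).
rewrite le_eqVlt; apply/orP; left; apply/eqP.
transitivity (\int[Lambda]_K (\1_(hitting (cball p 1%R)) K)%:E); last first.
  by rewrite integral_indic ?setIT//; exact: measurable_hitting (@compact_cball _ _ _ _).
apply: eq_integral => K _; rewrite indicE hitting_cball.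
(* If [K] hits the unit ball about [p], the isometries bringing its center into [cball b r] have
   Haar measure 1; otherwise the section is empty. *)
have [Kp|Kp] := boolP (K \in _).
  rewrite inE /= in Kp.
  rewrite (_ : [set f | _] = [set f | cball b r ((f : I) (c K))]).
    by rewrite -(volumeE norm_lambda _ (measurable_cball _ _)) vol_br.
  by apply/seteqP; split => f; [case|split].
rewrite (_ : [set f | _] = set0) ?measure0//; apply/seteqP; split => // f [_ /= Kp'].
by move: Kp; rewrite notin_setE.
Qed.

End mass_transport.

(** * Equivalence of the finiteness conditions *)

Local Open Scope ereal_scope.

Theorem theorem2p3 (R : realType) (d : nat) (d_ge2 : (2 <= d)%N)
  (p : hyperbolic_space R d)
  (lambda : {measure set (borel (isometry_group (hyperbolic_space R d))) -> \bar R})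
  (haar_lambda : haar_measure lambda)
  (norm_lambda : haar_normalized lambda)
  (b0 : hyperbolic_space R d) (r0 : R)
  (vol_ball : volume (cball b0 r0) = 1)
  (dO : measure_display) (Omega : measurableType dO) (P : probability Omega R)
  (zeta : R.-ker Omega ~> borel (particle (hyperbolic_space R d)))
  (zeta_process : particle_process P zeta)
  (zeta_stationary : stationary P zeta)
  (c : borel (particle (hyperbolic_space R d)) -> borel (hyperbolic_space R d))
  (c_center : center_function c)
  (gamma_gt0 : 0 < intensity P zeta c (cball b0 r0))
  (dO' : measure_display) (Omega' : measurableType dO')
  (P' : probability Omega' R)
  (G : {RV P' >-> borel (particle (hyperbolic_space R d))})
  (G_typical : intensity P zeta c (cball b0 r0) < +oo ->
     typical_distribution P zeta p lambda c (intensity P zeta c (cball b0 r0))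
       (distribution P' G)) :
  [/\ (forall C : set (hyperbolic_space R d), compact C ->
         intensity_measure P zeta (hitting C) < +oo) <->
      intensity_measure P zeta (hitting (cball p 1%R)) < +oo,
      intensity_measure P zeta (hitting (cball p 1%R)) < +oo <->
      (intensity P zeta c (cball b0 r0) < +oo /\
       \int[P']_w parallel_volume (G w) < +oo) &
      forall C0 : set (hyperbolic_space R d),
        compact C0 -> interior C0 !=set0 ->
        ((forall C : set (hyperbolic_space R d), compact C ->
            intensity_measure P zeta (hitting C) < +oo) <->
         intensity_measure P zeta (hitting C0) < +oo) ].
Proof.
have d_gt0 : (0 < d)%N by exact: leq_trans d_ge2.
pose Lambda := intensity_measure P zeta.
have p_int : interior (cball p 1%R) !=set0.
  exists p; apply: (filterS _ (nbhsx_ballx p _ ltr01)) => z.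
  by rewrite ballEmdist => /ltW.
have all_fin (C0 : set (hyperbolic_space R d)) : compact C0 -> interior C0 !=set0 ->
    (forall C : set (hyperbolic_space R d), compact C -> Lambda (hitting C) < +oo) <->
    Lambda (hitting C0) < +oo.
  move=> cC0 C00; split=> [|fin C cC]; first exact.
  exact: (intensity_hitting_fin zeta_stationary cC0 C00 fin cC).
have typE : intensity P zeta c (cball b0 r0) < +oo ->
    Lambda (hitting (cball p 1%R)) =
    intensity P zeta c (cball b0 r0) * \int[P']_w parallel_volume (G w).
  move=> /G_typical typ.
  rewrite /Lambda (typical_hitting haar_lambda norm_lambda 1 typ).
  rewrite ge0_integral_distribution//.
    exact: (measurable_volume_parallel_set haar_lambda norm_lambda d_gt0 vol_ball).
  move=> K; rewrite (volumeE norm_lambda p (measurable_parallel_set _ _)).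
  exact: measure_ge0.
split; [exact: all_fin (@compact_cball _ _ _ _) _| |exact: all_fin].
split=> [fin|[gfin Efin]].
  have gfin : intensity P zeta c (cball b0 r0) < +oo.
    have := intensity_volume_le haar_lambda norm_lambda d_gt0 vol_ball c_center
      zeta_stationary fin.
    (* Since the unit ball has positive volume, an infinite intensity would make the lower bound for
       [Lambda] infinite. *)
    have v0 := volume_cball_gt0 haar_lambda norm_lambda vol_ball p ltr01.
    rewrite [leLHS]muleC ltNge leye_eq; apply: contraTN => /eqP ->.
    by rewrite gt0_muley// -ltNge.
  (* Since the intensity is positive, an infinite mean parallel volume would contradict [fin]
     through [typE]. *)
  split=> //; rewrite ltNge leye_eq; apply/negP => /eqP Eoo.
  by move: fin; rewrite -/Lambda typE// Eoo gt0_muley// ltxx.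
rewrite -/Lambda typE//; apply: lte_mul_pinfty => //; first exact: ltW.
by rewrite fin_numE gt_eqF ?lt_eqF// (lt_trans _ gamma_gt0).
Qed.
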